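(* Let $K=\mathbb{F}_q$ be a finite field. Let $\mathcal{G}$ be a bipartite simple graph with a perfect matching, labelled as in the context, with $2k$ vertices and $s$ edges; let $\mathbb{X}\subseteq\mathbb{P}^{s-1}$ be the toric set parameterized by its edges, $C_{\mathbb{X}}(d)$ the associated code of order $d$, and $\mathbb{Y}\subseteq\mathbb{X}$ the set defined in the context. For $d\ge0$ let $H_{\psi}(d)=\dim_K(I_{\mathbb{Y}}(d)/I_{\mathbb{X}}(d))$. Then for all integers $d\ge0$, $$\dim_K C_{\mathbb{X}}(d)=H_{\mathbb{X}}(d)=H_{\psi}(d)+H_{\mathbb{T}_{k-1}}(d).$$
   Context: Setting: $\mathcal{G}$ is a bipartite simple graph on vertices $v_1,\ldots,v_{2k}$ with $s$ edges, every edge joining a vertex of $\{v_1,v_3,\ldots,v_{2k-1}\}$ to a vertex of $\{v_2,v_4,\ldots,v_{2k}\}$, and $\{\{v_{2i-1},v_{2i}\}: i=1,\ldots,k\}$ is a perfect matching of $\mathcal{G}$. Let $n_i=\deg v_i$, so $n_1+n_3+\cdots+n_{2k-1}=s$. The edges are ordered in consecutive blocks: first the $n_1$ edges incident with $v_1$ (starting with $\{v_1,v_2\}$), then the $n_3$ edges incident with $v_3$ (starting with $\{v_3,v_4\}$), and so on, finally the $n_{2k-1}$ edges incident with $v_{2k-1}$ (starting with $\{v_{2k-1},v_{2k}\}$). With $K^*=K\setminus\{0\}$, the toric set parameterized by the edges is the set $\mathbb{X}\subseteq\mathbb{P}^{s-1}$ of all points, for $(t_1,\ldots,t_{2k})\in(K^*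 )^{2k}$, whose coordinate at the edge $\{v_j,v_l\}$ is $t_jt_l$ (coordinates ordered as the edges are: first the $n_1$ edges incident with $v_1$, then the $n_3$ edges incident with $v_3$, and so on, finally the $n_{2k-1}$ edges incident with $v_{2k-1}$, the block of $v_{2i-1}$ starting with the edge $\{v_{2i-1},v_{2i}\}$). Further $$\mathbb{Y}=\{[t_1,\ldots,t_1,t_3,\ldots,t_3,\ldots,t_{2k-1},\ldots,t_{2k-1}]\in\mathbb{P}^{s-1}: t_i\in K^*\},$$ where $t_i$ appears $n_i$ times for $i=1,3,\ldots,2k-1$. The projective torus is $\mathbb{T}_{k-1}=\{[t_1,\ldots,t_k]\in\mathbb{P}^{k-1}: t_i\in K^*\}$. For a set of points $\mathbb{Z}\subseteq\mathbb{P}^{r-1}$ and $A=K[X_1,\ldots,X_r]=\oplus_{d\ge0}A_d$ with the standard grading, $I_{\mathbb{Z}}\subseteq A$ is the ideal generated by the homogeneous polynomials vanishing at all points of $\mathbb{Z}$, $I_{\mathbb{Z}}(d)=I_{\mathbb{Z}}\cap A_d$, and $H_{\mathbb{Z}}(d)=\dim_K(A_d/I_{\mathbb{Z}}(d))$. Since $\mathbb{Y}\subseteq\mathbb{X}$, $I_{\mathbb{X}}\subseteq I_{\mathbb{Y}}$. If $\mathbb{X}=\{P_1,\ldots,P_{|\mathbb{X}|}\}$ and $S=K[X_1,\ldots,X_s]$, the code of order $d$ is $$C_{\mathbb{X}}(d)=\left\{\left(\frac{f(P_1)}{X_1^d(P_1)},\ldots,\frac{f(P_{|\mathbb{X}|})}{X_1^d(P_{|\mathbb{X}|})}\right):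 f\in S_d\right\}\subseteq K^{|\mathbb{X}|}.$$ *)

(* Defs.v *)
From HB Require Import structures.
From mathcomp Require Import all_boot all_order all_algebra all_field.
From mathcomp Require Import generic_quotient ring_quotient.
From mathcomp Require Import boolp.
From mathcomp Require Import mpoly.

Set Implicit Arguments.
Unset Strict Implicit.
Unset Printing Implicit Defensive.

Import GRing.Theory.

Local Open Scope ring_scope.
Local Open Scope quotient_scope.

(* MathComp only equips V / U with a Z-module structure; it is extended here to
   a finite-dimensional vector space. *)
Section QuotientSpace.
Variables (F : fieldType) (vT : vectType F) (U : {vspace vT}).

Definition quotv : Type := Quotient.quot (pred_of_vspace U).

HB.instance Definition _ := GRing.Zmodule.on quotv.

Definition quotv_pi (v : vT) : quotv :=
  \pi_(Quotient.quot (pred_of_vspace U)) v.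
Definition quotv_repr (x : quotv) : vT :=
  repr (x : Quotient.quot (pred_of_vspace U)).

Lemma quotv_reprK : cancel quotv_repr quotv_pi.
Proof. exact: reprK. Qed.

Lemma quotv_pi_eq (u v : vT) : (quotv_pi u == quotv_pi v) = (u - v \in U).
Proof. by rewrite -[RHS]/(u - v \in pred_of_vspace U) Quotient.idealrBE. Qed.

Lemma quotv_piD : {morph quotv_pi : u v / u + v}.
Proof. exact: raddfD. Qed.

Definition quotv_scale (a : F) (x : quotv) : quotv :=
  quotv_pi (a *: quotv_repr x).

Lemma quotv_piZ a v : quotv_pi (a *: v) = quotv_scale a (quotv_pi v).
Proof.
apply/eqP; rewrite quotv_pi_eq -scalerBr memvZ //.
by rewrite -quotv_pi_eq quotv_reprK.
Qed.

Fact quotv_scaleA a b x :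
  quotv_scale a (quotv_scale b x) = quotv_scale (a * b) x.
Proof. by rewrite -[x]quotv_reprK -!quotv_piZ scalerA. Qed.
Fact quotv_scale1 : left_id 1 quotv_scale.
Proof. by move=> x; rewrite -[x in LHS]quotv_reprK -quotv_piZ scale1r quotv_reprK. Qed.
Fact quotv_scaleDr : right_distributive quotv_scale +%R.
Proof.
move=> a x y; rewrite -[x]quotv_reprK -[y]quotv_reprK -quotv_piD -!quotv_piZ.
by rewrite scalerDr quotv_piD.
Qed.
Fact quotv_scaleDl x : {morph quotv_scale^~ x : a b / a + b}.
Proof.
by move=> a b; rewrite -[x]quotv_reprK -!quotv_piZ scalerDl quotv_piD.
Qed.

HB.instance Definition _ := GRing.Zmodule_isLmodule.Build F quotv
  quotv_scaleA quotv_scale1 quotv_scaleDr quotv_scaleDl.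

Fact quotv_pi_is_linear : linear quotv_pi.
Proof. by move=> a u v; rewrite quotv_piD quotv_piZ. Qed.

HB.instance Definition _ := GRing.isLinear.Build F vT quotv _ quotv_pi
  quotv_pi_is_linear.

Fact quotv_vectaxiom : Vector.axiom (\dim (U^C)%VS) quotv.
Proof.
pose W := (U^C)%VS.
have WU0 : (W :&: U = 0)%VS by rewrite capvC capv_compl.
have WUf v : v \in (W + U)%VS by rewrite addvC addv_complf memvf.
pose p : 'End(vT) := daddv_pi W U.
have pi_p v : quotv_pi (p v) = quotv_pi v.
  apply/eqP; rewrite quotv_pi_eq -[X in _ - X](daddv_pi_add WU0 (WUf v)).
  by rewrite opprD addNKr memvN memv_pi.
have p_eq u v : quotv_pi u = quotv_pi v -> p u = p v.
  move/eqP; rewrite quotv_pi_eq => uvU; apply/eqP.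
  rewrite -subr_eq0 -linearB; have:= daddv_pi_add WU0 (WUf (u - v)).
  have UW0 : (U :&: W = 0)%VS by rewrite capvC.
  by rewrite (daddv_pi_id UW0 uvU) => /eqP; rewrite -subr_eq0 addrK.
pose f (x : quotv) : 'rV[F]_(\dim W) :=
  \row_i coord (vbasis W) i (p (quotv_repr x)).
have fpi v : f (quotv_pi v) = \row_i coord (vbasis W) i (p v).
  by apply/rowP=> i; rewrite !mxE (@p_eq _ v) ?quotv_reprK.
pose g (r : 'rV[F]_(\dim W)) : quotv :=
  quotv_pi (\sum_i r 0 i *: (vbasis W)`_i).
exists f.
  move=> a x y; rewrite -[x]quotv_reprK -[y]quotv_reprK -linearP !fpi.
  by apply/rowP=> i; rewrite !mxE !linearP.
exists g => [x|r].
  rewrite -[x in LHS]quotv_reprK fpi -[RHS]quotv_reprK -[RHS]pi_p /g.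
  congr quotv_pi; rewrite [RHS](coord_vbasis (memv_pi W U _)).
  by apply: eq_bigr => i _; rewrite mxE.
rewrite /g fpi; apply/rowP=> i; rewrite mxE.
rewrite [p _]daddv_pi_id //; last first.
  by apply: memv_suml => j _; rewrite memvZ // vbasis_mem // mem_nth ?size_tuple.
by rewrite coord_sum_free // (basis_free (vbasisP W)).
Qed.

HB.instance Definition _ := Lmodule_hasFinDim.Build F quotv quotv_vectaxiom.

End QuotientSpace.

(* W / U as a subspace of V / U, meant for U <= W. *)
Definition quotvs (F : fieldType) (vT : vectType F) (W U : {vspace vT}) :
    {vspace quotv U} :=
  (linfun (@quotv_pi F vT U) @: W)%VS.

Section Projective.
Variables (K : finFieldType) (n : nat).

(* A point of P^n is the set of all its vectors of homogeneous coordinates. *)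
Record proj_point := ProjPoint {
  proj_set :> {set 'rV[K]_n.+1};
  _ : [exists v : 'rV[K]_n.+1,
         (v != 0) && (proj_set == [set a *: v | a : K & a != 0])]
}.

HB.instance Definition _ := [isSub for proj_set].
HB.instance Definition _ := [Finite of proj_point by <:].

Implicit Types (P : proj_point) (Z : {set proj_point}) (d : nat).

Lemma proj_pointP P : exists2 v : 'rV[K]_n.+1, v != 0 &
  proj_set P = [set a *: v | a : K & a != 0].
Proof. by case: P => /= A /existsP[v /andP[v0 /eqP]]; exists v. Qed.

(* The points [x t] of P^n, t in A; values [x t = 0] contribute no point. *)
Definition proj_image (T : finType) (A : {set T}) (x : T -> 'rV[K]_n.+1) :
    {set proj_point} :=
  [set P : proj_point | [exists t in A, x t \in proj_set P]].

Definition vanishes_on (g : {mpoly K[n.+1]}) Z : Prop :=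
  forall P (v : 'rV[K]_n.+1), P \in Z -> v \in proj_set P -> g.@[v 0] = 0.

Definition vanishing_ideal Z (f : {mpoly K[n.+1]}) : Prop :=
  exists (m : nat) (c g : 'I_m -> {mpoly K[n.+1]}),
    (forall i, (exists e, g i \is e.-homog) /\ vanishes_on (g i) Z) /\
    f = \sum_i c i * g i.

(* The degree [d] forms are finite in number, so the degree [d] part of the
   ideal is a subspace spanned by the list of its elements. *)
Definition vanishing_form Z d : {vspace dhomog n.+1 K d} :=
  <<[seq f <- enum (finvect_type (dhomog n.+1 K d)) |
       `[< vanishing_ideal Z (mpoly_of_dhomog f) >] ]>>%VS.

Lemma vanishing_idealP Z a (f g : {mpoly K[n.+1]}) :
  vanishing_ideal Z f -> vanishing_ideal Z g -> vanishing_ideal Z (a *: f + g).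
Proof.
move=> [m1 [c1 [g1 [h1 ->]]]] [m2 [c2 [g2 [h2 ->]]]].
exists (m1 + m2)%N.
exists (fun i => match split i with inl j => a *: c1 j | inr j => c2 j end).
exists (fun i => match split i with inl j => g1 j | inr j => g2 j end).
split=> [i|]; first by case: (split i) => j.
rewrite big_split_ord /= scaler_sumr; congr (_ + _); apply: eq_bigr => i _.
  by rewrite (unsplitK (inl i)) scalerAl.
by rewrite (unsplitK (inr i)).
Qed.

Lemma mem_vanishing_form Z d (f : dhomog n.+1 K d) :
  f \in vanishing_form Z d <-> vanishing_ideal Z f.
Proof.
rewrite /vanishing_form; set s := [seq _ <- _ | _].
split=> [fs|fI]; last first.
  by apply: memv_span; rewrite mem_filter asboolT //= (mem_enum (finvect_type _)).
rewrite (coord_span (X := in_tuple s) fs) linear_sum.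
apply: (big_ind (vanishing_ideal Z)) => [|x y hx hy|i _].
- exists 0%N, (fun=> 0), (fun=> 0); split=> [[]//|].
  by rewrite big_ord0.
- by rewrite -[x]scale1r; apply: vanishing_idealP.
rewrite linearZ /= -[_ *: _]addr0; apply: vanishing_idealP; last first.
  exists 0%N, (fun=> 0), (fun=> 0); split=> [[]//|].
  by rewrite big_ord0.
have /(mem_nth 0) : (i < size s)%N by rewrite -[size s]/(size (in_tuple s)).
by rewrite mem_filter => /andP[/asboolP].
Qed.

Definition hilbert Z d : nat := \dim {: quotv (vanishing_form Z d)}%VS.

(* dim I_Y(d) / I_X(d), meant for Y a subset of X *)
Definition hilbert_psi (Y X : {set proj_point}) d : nat :=
  \dim (quotvs (vanishing_form Y d) (vanishing_form X d)).

Definition proj_rep P : 'rV[K]_n.+1 := odflt 0 [pick v in proj_set P].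

Lemma proj_repP P : proj_rep P \in proj_set P.
Proof.
have [v v0 PE] := proj_pointP P; rewrite /proj_rep; case: pickP => //= /(_ v).
by rewrite PE => /imsetP[]; exists 1; rewrite ?scale1r // inE oner_neq0.
Qed.

(* f(P_i) / X_1^d(P_i), where X_1 is the variable of index [ord0]; the chosen
   homogeneous coordinates are irrelevant by [codewordE] below. *)
Definition codeword Z d (f : dhomog n.+1 K d) : 'rV[K]_#|Z| :=
  \row_i ((mpoly_of_dhomog f).@[proj_rep (enum_val i) 0]
          / proj_rep (enum_val i) 0 ord0 ^+ d).

Fact codeword_is_linear Z d : linear (@codeword Z d).
Proof.
by move=> a f g; apply/rowP=> i; rewrite !mxE (linearP (@mpoly_of_dhomog _ _ _)) mevalD mevalZ
  mulrDl mulrA.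
Qed.

HB.instance Definition _ Z d := GRing.isLinear.Build K (dhomog n.+1 K d)
  'rV[K]_#|Z| _ (@codeword Z d) (@codeword_is_linear Z d).

Lemma meval_form d (f : dhomog n.+1 K d) a (v : 'rV[K]_n.+1) :
  (mpoly_of_dhomog f).@[(a *: v) 0] = a ^+ d * (mpoly_of_dhomog f).@[v 0].
Proof.
case: f => f /= /dhomogP fd; rewrite !mevalE mulr_sumr.
rewrite big_seq [RHS]big_seq; apply: eq_bigr => m /fd md.
rewrite mulrCA; congr (_ * _).
under eq_bigr do rewrite mxE exprMn.
by rewrite big_split /= -expr_sum -mdegE; congr (_ ^+ _ * _).
Qed.

Lemma codewordE Z d (f : dhomog n.+1 K d) i (v : 'rV[K]_n.+1) :
  v \in proj_set (enum_val i) ->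
  codeword Z f 0 i = (mpoly_of_dhomog f).@[v 0] / v 0 ord0 ^+ d.
Proof.
have [w w0 PE] := proj_pointP (enum_val i).
have := proj_repP (enum_val i); rewrite mxE PE.
case/imsetP=> a a0 -> /imsetP[b b0 ->]; rewrite !meval_form !mxE !exprMn.
rewrite !inE in a0 b0.
by rewrite -!mulf_div !divff ?expf_neq0 // !mul1r.
Qed.

Definition eval_code Z d : {vspace 'rV[K]_#|Z|} :=
  limg (linfun (@codeword Z d)).

End Projective.

Definition nonzero_tuples (K : finFieldType) (I : finType) :
    {set {ffun I -> K}} :=
  [set t : {ffun I -> K} | [forall i, t i != 0]].

Definition proj_torus (K : finFieldType) (n : nat) : {set proj_point K n} :=
  proj_image (nonzero_tuples K 'I_n.+1) (fun t => \row_i t i).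

(* The vertex v_(j+1) is the element [j] of 'I_(2k). *)
Section Graph.
Variables (k : nat).

Fact odd_vertex_subproof (i : 'I_k) : (i.*2 < k.*2)%N.
Proof. by rewrite ltn_double. Qed.
Fact even_vertex_subproof (i : 'I_k) : (i.*2.+1 < k.*2)%N.
Proof. by rewrite ltn_Sdouble. Qed.

(* [odd_vertex i] is v_(2i+1) and [even_vertex i] is v_(2i+2). *)
Definition odd_vertex (i : 'I_k) : 'I_(k.*2) := Ordinal (odd_vertex_subproof i).
Definition even_vertex (i : 'I_k) : 'I_(k.*2) := Ordinal (even_vertex_subproof i).

Variable e : rel 'I_(k.*2).

(* The pairs {v_(2i-1), v_(2i)} partition the vertices: they form a perfect
   matching as soon as they are edges. *)
Record matched_bipartite : Prop := MatchedBipartite {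
  adj_sym : ssrbool.symmetric e;
  adj_irr : irreflexive e;
  adj_bipartite : forall x y, e x y -> odd x != odd y;
  adj_matching : forall i, e (odd_vertex i) (even_vertex i)
}.

Definition degree (x : 'I_(k.*2)) : nat := #|[set y | e x y]|.

Definition edge_set : {set {set 'I_(k.*2)}} :=
  [set [set p.1; p.2] | p : 'I_(k.*2) * 'I_(k.*2) & e p.1 p.2].

(* Edges come in consecutive blocks, one for each v_(2i-1) in increasing order
   of i, each block starting with {v_(2i-1), v_(2i)}. *)
Record edge_ordering (s : nat) (ed : s.-tuple {set 'I_(k.*2)}) : Prop :=
  EdgeOrdering {
    edges_uniq : uniq ed;
    edges_mem : ed =i edge_set;
    edges_blocks : forall (a b : 'I_s) (i j : 'I_k), (a <= b)%N ->
      odd_vertex i \in tnth ed a -> odd_vertex j \in tnth ed b -> (i <= j)%N;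
    edges_start : forall (a : 'I_s) (i : 'I_k), odd_vertex i \in tnth ed a ->
      (index [set odd_vertex i; even_vertex i] ed <= a)%N
  }.

Variables (K : finFieldType) (s : nat).

(* The product over the edge {v_j, v_l} is t_j t_l. *)
Definition edge_point (ed : s.+1.-tuple {set 'I_(k.*2)})
    (t : {ffun 'I_(k.*2) -> K}) : 'rV[K]_s.+1 :=
  \row_a \prod_(x in tnth ed a) t x.

Definition toric_set (ed : s.+1.-tuple {set 'I_(k.*2)}) :
    {set proj_point K s} :=
  proj_image (nonzero_tuples K 'I_(k.*2)) (edge_point ed).

(* t_1 repeated n_1 times, t_3 repeated n_3 times, etc. *)
Definition block_point (t : {ffun 'I_k -> K}) : 'rV[K]_s.+1 :=
  \row_a (flatten [seq nseq (degree (odd_vertex i)) (t i) | i <- enum 'I_k])`_a.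

Definition block_set : {set proj_point K s} :=
  proj_image (nonzero_tuples K 'I_k) block_point.

End Graph.

(* Main.v *)
(* A form of degree d lies in I_Z(d) exactly when it vanishes on Z.  Hence
   I_X(d) is the kernel of the evaluation map defining the code, since X_1 has
   no zero on X, and, as Y is contained in X,
   H_X(d) - H_psi(d) = dim S_d - dim I_Y(d) = H_Y(d).

   It remains to see that H_Y = H_T.  The substitution X_a |-> X_(i(a)), where
   a lies in the block of v_(2i(a)-1), turns evaluation at the point of Y with
   parameters t into evaluation at the point [t] of the torus, and substituting
   for X_i the variable of an edge of the i-th block goes the other way.  Both
   preserve degree, so each Hilbert function is bounded by the other. *)
From HB Require Import structures.
Require Import Defs.
From mathcomp Require Import all_boot all_algebra.
From mathcomp Require Import mpoly.

Set Implicit Arguments.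
Unset Strict Implicit.
Unset Printing Implicit Defensive.

Import GRing.Theory.

Local Open Scope ring_scope.

(** * Dimensions of quotient spaces *)

Section QuotientDimension.
Variables (F : fieldType) (vT : vectType F).
Implicit Types U V : {vspace vT}.

Lemma dim_quotv U : (\dim {: quotv U} + \dim U)%N = \dim {: vT}.
Proof.
have -> : \dim {: quotv U} = \dim (U^C)%VS by rewrite dimvf.
by rewrite dimv_compl subnK ?dimvS ?subvf.
Qed.

Lemma dim_quotv_lker (wT : vectType F) (f : 'Hom(vT, wT)) :
  \dim {: quotv (lker f)} = \dim (limg f).
Proof.
apply/eqP; rewrite -(eqn_add2r (\dim (lker f))) dim_quotv.
by rewrite -(limg_ker_dim f fullv) capfv addnC.
Qed.

Lemma lker_quotv_pi U : lker (linfun (@quotv_pi F vT U)) = U.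
Proof.
apply/vspaceP=> v; rewrite memv_ker lfunE /=.
by rewrite -[0](linear0 (@quotv_pi F vT U)) quotv_pi_eq subr0.
Qed.

Lemma dim_quotvs V U :
  (U <= V)%VS -> (\dim (quotvs V U) + \dim U)%N = \dim V.
Proof.
move=> UV; rewrite -(limg_ker_dim (linfun (@quotv_pi F vT U)) V).
by rewrite lker_quotv_pi (capv_idPr UV) addnC.
Qed.

End QuotientDimension.

(** As the preimage of [W], [U] is the kernel of [f] followed by the projection modulo [W]; the
    dimension of the quotient by [U] is thus that of the image of this composite. *)
Lemma leq_dim_quotv (F : fieldType) (vT wT : vectType F)
    (f : {linear vT -> wT}) (U : {vspace vT}) (W : {vspace wT}) :
  (forall v, (v \in U) = (f v \in W)) ->
  (\dim {: quotv U} <= \dim {: quotv W})%N.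
Proof.
move=> fUW.
have -> : U = lker (linfun (@quotv_pi F wT W) \o linfun f)%VF.
  apply/vspaceP=> v; rewrite memv_ker comp_lfunE fUW [linfun f _]lfunE.
  by rewrite -{1}(lker_quotv_pi W) memv_ker.
by rewrite dim_quotv_lker dimvS ?subvf.
Qed.

(** * Substitution of variables for variables in forms *)

Section Substitution.
Variables (R : comNzRingType) (n m : nat) (h : 'I_n -> 'I_m).

Definition subst_mpoly (f : {mpoly R[n]}) : {mpoly R[m]} :=
  f \mPo [tuple 'X_(h i) | i < n].

Lemma meval_subst_mpoly f v : (subst_mpoly f).@[v] = f.@[v \o h].
Proof.
rewrite comp_mpoly_meval; apply: meval_eq => i /=.
by rewrite tnth_mktuple mevalXU.
Qed.

Lemma subst_mpoly_homog d f : f \is d.-homog -> subst_mpoly f \is d.-homog.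
Proof.
move/dhomogP=> fd; rewrite /subst_mpoly comp_mpolyEX big_seq.
apply: rpred_sum => a /fd; rewrite comp_mpolyX /= => <-; apply: rpredZ.
rewrite mdegE.
elim/big_ind2: _ => [|????|i _]; [exact: dhomog1|exact: dhomogM|].
have Xh : ('X_(h i) : {mpoly R[m]}) \is 1.-homog by rewrite dhomogX /= mdeg1.
by rewrite tnth_mktuple; have := dhomogMn (a i) Xh; rewrite mul1n.
Qed.

End Substitution.

Section SubstForm.
Variables (K : finFieldType) (n m : nat) (h : 'I_n.+1 -> 'I_m.+1) (d : nat).

Definition subst_form (f : dhomog n.+1 K d) : dhomog m.+1 K d :=
  DHomog (subst_mpoly_homog h (dhomog_is_dhomog f)).

Fact subst_form_is_linear : linear subst_form.
Proof. by move=> a f g; apply: val_inj; rewrite /= /subst_mpoly linearP. Qed.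

HB.instance Definition _ := GRing.isLinear.Build K (dhomog n.+1 K d)
  (dhomog m.+1 K d) _ subst_form subst_form_is_linear.

End SubstForm.

(** * Graded pieces of vanishing ideals and the evaluation code *)

Section Vanishing.
Variables (K : finFieldType) (n : nat).
Implicit Types (Z : {set proj_point K n}) (d : nat).

(** Combinations of generators vanishing on [Z] vanish on [Z]; conversely, a form vanishing on [Z]
    is itself a generator. *)
Lemma vanishing_formP Z d (f : dhomog n.+1 K d) :
  reflect (vanishes_on (mpoly_of_dhomog f) Z) (f \in vanishing_form Z d).
Proof.
apply: (iffP idP) => [/mem_vanishing_form[m [c [g [gP ->]]]] P v PZ vP|fZ].
  rewrite raddf_sum big1 //= => i _; rewrite mevalM.
  by have [_ /(_ _ _ PZ vP)->] := gP i; rewrite mulr0.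
apply/mem_vanishing_form; exists 1%N, (fun=> 1), (fun=> mpoly_of_dhomog f).
split; last by rewrite big_ord1 mul1r.
by split=> //; exists d; apply: dhomog_is_dhomog.
Qed.

Lemma mem_proj_image (T : finType) (A : {set T}) (x : T -> 'rV[K]_n.+1) t :
  t \in A -> x t != 0 ->
  exists2 P, P \in proj_image A x & x t \in proj_set P.
Proof.
move=> tA xt0; pose S := [set a *: x t | a : K & a != 0].
have SP : [exists v : 'rV[K]_n.+1, (v != 0) &&
    (S == [set a *: v | a : K & a != 0])].
  by apply/existsP; exists (x t); rewrite xt0 eqxx.
have xS : x t \in proj_set (ProjPoint SP).
  by apply/imsetP; exists 1; rewrite ?scale1r // inE oner_neq0.
exists (ProjPoint SP) => //.
by rewrite inE; apply/existsP; exists t; rewrite tA.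
Qed.

(** Vanishing of a form does not depend on the homogeneous coordinates, so the vectors [x t] suffice
    as test points; being nonzero, each of them represents a point. *)
Lemma vanishing_form_imageP (T : finType) (A : {set T}) (x : T -> 'rV[K]_n.+1)
    d (f : dhomog n.+1 K d) :
  (forall t, t \in A -> x t != 0) ->
  reflect (forall t, t \in A -> (mpoly_of_dhomog f).@[x t 0] = 0)
    (f \in vanishing_form (proj_image A x) d).
Proof.
move=> x0; apply: (iffP (vanishing_formP _ _)) => [fZ t tA|fA P v].
  by have [P PZ xP] := mem_proj_image tA (x0 t tA); apply: fZ PZ xP.
rewrite inE => /existsP[t /andP[tA]]; have [w w0 ->] := proj_pointP P.
case/imsetP=> a; rewrite inE => a0 xE /imsetP[b _ ->].
have /eqP := fA t tA; rewrite xE !meval_form mulf_eq0 expf_eq0 (negPf a0) andbF.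
by move/eqP->; rewrite mulr0.
Qed.

Lemma vanishing_formS Z1 Z2 d :
  Z1 \subset Z2 -> (vanishing_form Z2 d <= vanishing_form Z1 d)%VS.
Proof.
move/subsetP=> Z12; apply/subvP=> f /vanishing_formP fZ.
by apply/vanishing_formP=> P v /Z12; apply: fZ.
Qed.

Lemma dim_eval_code Z d :
  (forall P (v : 'rV[K]_n.+1), P \in Z -> v \in proj_set P -> v 0 ord0 != 0) ->
  \dim (eval_code Z d) = hilbert Z d.
Proof.
move=> Z0; rewrite /eval_code -dim_quotv_lker /hilbert.
suff -> : lker (linfun (@codeword K n Z d)) = vanishing_form Z d by [].
apply/vspaceP=> f; rewrite memv_ker lfunE /=.
apply/eqP/vanishing_formP => [f0 P v PZ vP|fZ]; last first.
  apply/rowP=> i; rewrite !mxE.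
  by rewrite (fZ (enum_val i)) ?mul0r ?proj_repP ?enum_valP.
(* The entry at [P] may be computed with the coordinates [v]; its denominator is nonzero, so the
   numerator vanishes. *)
have /rowP/(_ (enum_rank_in PZ P)) := f0.
rewrite (codewordE _ (v := v)) ?enum_rankK_in // mxE => /eqP.
rewrite mulf_eq0 invr_eq0 expf_eq0 (negPf (Z0 P v PZ vP)).
by rewrite andbF orbF => /eqP.
Qed.

(** After adding dim I_X(d), both sides become the dimension of the space of all forms of degree
    [d], since I_X(d) lies in I_Y(d). *)
Lemma hilbert_psiD (Y X : {set proj_point K n}) d :
  Y \subset X -> hilbert X d = (hilbert_psi Y X d + hilbert Y d)%N.
Proof.
move=> YX; apply/eqP.
rewrite -(eqn_add2r (\dim (vanishing_form X d))) dim_quotv addnAC.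
by rewrite (dim_quotvs (vanishing_formS d YX)) addnC dim_quotv.
Qed.

End Vanishing.

(** Substituting along [h] turns the value at [x t] into the value at [y t], so one space of
    vanishing forms is the preimage of the other. *)
Lemma leq_hilbert_image (K : finFieldType) (n m : nat) (T : finType)
    (A : {set T}) (x : T -> 'rV[K]_n.+1) (y : T -> 'rV[K]_m.+1)
    (h : 'I_n.+1 -> 'I_m.+1) d :
  (forall t, t \in A -> x t != 0) -> (forall t, t \in A -> y t != 0) ->
  (forall t i, t \in A -> x t 0 i = y t 0 (h i)) ->
  (hilbert (proj_image A x) d <= hilbert (proj_image A y) d)%N.
Proof.
move=> x0 y0 xy; apply: (leq_dim_quotv (f := @subst_form K n m h d)) => f.
have E t : t \in A ->
    (mpoly_of_dhomog (subst_form h f)).@[y t 0] = (mpoly_of_dhomog f).@[x t 0].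
  by move=> tA; rewrite meval_subst_mpoly; apply: meval_eq => i /=; rewrite xy.
apply/(vanishing_form_imageP _ x0)/(vanishing_form_imageP _ y0) => fA t tA.
  by rewrite E ?fA.
by rewrite -E ?fA.
Qed.


(** * Vertex indices and sorted sequences *)

Lemma odd_vertex_inj k : injective (@odd_vertex k).
Proof. by move=> i j [/double_inj/val_inj]. Qed.

(** Indices start at 0, so v_1, v_3, ... are the even ordinals. *)
Lemma odd_vertexP k (x : 'I_(k.*2)) : ~~ odd x -> exists i, x = odd_vertex i.
Proof.
move=> x_even; have xE := odd_double_half x; rewrite (negPf x_even) add0n in xE.
have lt_xk : (x./2 < k)%N by rewrite -ltn_double xE.
by exists (Ordinal lt_xk); apply: val_inj; rewrite /= xE.
Qed.

(** Both sides are sorted for an antisymmetric order and contain each element equally often. *)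
Lemma sorted_nseqE n (r : seq 'I_n) :
  sorted (fun i j : 'I_n => (i <= j)%N) r ->
  r = flatten [seq nseq (count_mem i r) i | i <- enum 'I_n].
Proof.
pose le (i j : 'I_n) := (i <= j)%N.
have le_trans : transitive le by move=> ? ? ?; apply: leq_trans.
move=> r_sorted; apply: (sorted_eq le_trans) => //.
- by move=> i j /anti_leq/val_inj.
- have : pairwise (fun i j : 'I_n => (i < j)%N) (enum 'I_n).
    rewrite -(pairwise_map val ltn) val_enum_ord -(sorted_pairwise ltn_trans).
    exact: iota_ltn_sorted.
  rewrite (sorted_pairwise le_trans).
  elim: (enum _) => //= i l IH /andP[il /IH l_sorted].
  rewrite pairwise_cat l_sorted andbT; apply/andP; split.
    apply/allrelP=> a b /nseqP[-> _] /flatten_mapP[j jl /nseqP[-> _]].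
    by rewrite /le ltnW // (allP il).
  by elim: (count_mem i r) => //= c ->; rewrite all_nseq /le leqnn orbT.
apply/allP=> i _; apply/eqP; rewrite /= count_flatten -map_comp sumnE big_map.
rewrite big_enum (bigD1 i) //= count_nseq /= eqxx mul1n big1 ?addn0 // => j ji.
by rewrite count_nseq /= (negPf ji).
Qed.

(** * Edge blocks and the sets X, Y *)

Section Blocks.
Variables (k s : nat) (e : rel 'I_((k.+1).*2)).
Hypothesis he : matched_bipartite e.
Variable ed : s.+1.-tuple {set 'I_((k.+1).*2)}.
Hypothesis hed : edge_ordering e ed.
Implicit Types (i j : 'I_k.+1) (E : {set 'I_((k.+1).*2)}).

(** An edge contains exactly one [odd_vertex i], so the default [ord0] never matters for edges. *)
Definition block E : 'I_k.+1 := odflt ord0 [pick i | odd_vertex i \in E].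

Lemma edge_setP E :
  reflect (exists i, exists2 y : 'I_((k.+1).*2), odd y &
             e (odd_vertex i) y /\ E = [set odd_vertex i; y])
          (E \in edge_set e).
Proof.
apply: (iffP imsetP) => [[[x y]]|[i [y _ [eiy ->]]]]; last first.
  by exists (odd_vertex i, y); rewrite ?inE.
rewrite inE /= => exy ->; have := adj_bipartite he exy.
have [x_odd|/odd_vertexP[i xE] /=] := boolP (odd x); last first.
  by case y_odd: (odd y) => // _; exists i, y; rewrite // -xE.
case: (boolP (odd y)) => // /odd_vertexP[i yE] _; exists i, x => //.
by rewrite -yE setUC (adj_sym he).
Qed.

Lemma mem_odd_vertex i j (y : 'I_((k.+1).*2)) :
  odd y -> (odd_vertex j \in [set odd_vertex i; y]) = (i == j).
Proof.
move=> y_odd; rewrite !inE (inj_eq (@odd_vertex_inj _)) orbC eq_sym.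
by case: eqP => //= yE; rewrite yE /= odd_double in y_odd.
Qed.

Lemma block_edge i (y : 'I_((k.+1).*2)) :
  odd y -> block [set odd_vertex i; y] = i.
Proof.
move=> y_odd; rewrite /block; case: pickP => [j|/(_ i)].
  by rewrite mem_odd_vertex // => /eqP.
by rewrite mem_odd_vertex // eqxx.
Qed.

Lemma mem_block E i :
  E \in edge_set e -> (odd_vertex i \in E) = (block E == i).
Proof.
by case/edge_setP=> j [y y_odd [_ ->]]; rewrite mem_odd_vertex // block_edge.
Qed.

(** Sending a neighbour [y] of [odd_vertex i] to the edge joining them is a bijection onto the
    block; injectivity holds because parity separates [y] from [odd_vertex i]. *)
Lemma count_block i :
  count_mem i (map block ed) = degree e (odd_vertex i).
Proof.
rewrite count_map -size_filter.
rewrite -(card_uniqP _) ?filter_uniq ?(edges_uniq hed) //.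
pose f y : {set 'I_((k.+1).*2)} := [set odd_vertex i; y].
have odd_nbr y : e (odd_vertex i) y -> odd y.
  by move/(adj_bipartite he); rewrite /= odd_double; case: (odd y).
rewrite /degree -(card_in_imset (f := f)); last first.
  move=> y z; rewrite !inE => /odd_nbr y_odd /odd_nbr z_odd /setP/(_ y).
  rewrite !inE eqxx orbT; case: eqP => [yE|_] /=; last by move/esym/eqP.
  by rewrite yE /= odd_double in y_odd.
apply: eq_card => E; rewrite mem_filter (edges_mem hed) /=.
apply/andP/imsetP => [[/eqP iE /edge_setP[j [y y_odd [ejy EE]]]]|[y]].
  have ji : j = i by rewrite -iE EE block_edge.
  by rewrite ji in ejy EE; exists y; rewrite ?inE.
rewrite inE => eiy ->; rewrite block_edge ?odd_nbr //; split=> //.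
by apply/edge_setP; exists i, y; rewrite ?odd_nbr.
Qed.

Lemma block_sorted : sorted (fun i j => (i <= j)%N) (map block ed).
Proof.
apply/(sortedP ord0) => a; rewrite size_map size_tuple => lt_a.
have lt_a' := ltnW lt_a; rewrite !(nth_map set0) ?size_tuple //.
have := edges_blocks hed (a := Ordinal lt_a') (b := Ordinal lt_a) (leqnSn a).
rewrite !(tnth_nth set0) /=; apply; rewrite mem_block ?eqxx // -(edges_mem hed);
  by rewrite mem_nth ?size_tuple.
Qed.

Lemma map_block :
  map block ed
  = flatten [seq nseq (degree e (odd_vertex i)) i | i <- enum 'I_k.+1].
Proof.
rewrite {1}(sorted_nseqE block_sorted); congr flatten.
by apply: eq_map => i; rewrite count_block.
Qed.

Lemma block_pointE (K : finFieldType) (t : {ffun 'I_k.+1 -> K}) (a : 'I_s.+1) :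
  block_point e s t 0 a = t (block (tnth ed a)).
Proof.
rewrite mxE; set b := flatten _.
have -> : b = map t (map block ed).
  rewrite map_block map_flatten -map_comp; congr flatten.
  by apply: eq_map => i /=; rewrite map_nseq.
rewrite (nth_map ord0) ?size_map ?size_tuple // (nth_map set0) ?size_tuple //.
by rewrite (tnth_nth set0).
Qed.

Lemma prod_edge (R : comNzRingType) E (t : 'I_((k.+1).*2) -> R) :
  E \in edge_set e -> (forall x : 'I_((k.+1).*2), odd x -> t x = 1) ->
  \prod_(x in E) t x = t (odd_vertex (block E)).
Proof.
move=> /edge_setP[i [y y_odd [_ ->]]] t1; rewrite block_edge // big_setU1 /=.
  by rewrite big_set1 (t1 y) ?mulr1.
by rewrite inE; apply: contraL y_odd => /eqP<-; rewrite /= odd_double.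
Qed.

Lemma block_set_sub (K : finFieldType) : block_set e K s \subset toric_set K ed.
Proof.
apply/subsetP=> P; rewrite !inE => /existsP[t /andP[tA tP]].
(* Setting the parameters of v_2, v_4, ... to 1 reduces each edge product to the parameter of its
   block. *)
pose u : {ffun 'I_((k.+1).*2) -> K} :=
  [ffun x : 'I_((k.+1).*2) => if odd x then 1 else t (inord x./2)].
rewrite inE in tA; apply/existsP; exists u; rewrite inE; apply/andP; split.
  apply/forallP=> x; rewrite ffunE; case: ifP => _; first exact: oner_neq0.
  exact: (forallP tA).
suff -> : edge_point ed u = block_point e s t by [].
apply/rowP=> a; rewrite block_pointE mxE prod_edge.
- by rewrite ffunE /= odd_double doubleK inord_val.
- by rewrite -(edges_mem hed) mem_tnth.
by move=> x x_odd; rewrite ffunE x_odd.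
Qed.

Lemma hilbert_block_set (K : finFieldType) d :
  hilbert (block_set e K s) d = hilbert (proj_torus K k) d.
Proof.
have tn0 (t : {ffun 'I_k.+1 -> K}) i :
    t \in nonzero_tuples K 'I_k.+1 -> t i != 0.
  by rewrite inE => /forallP.
have b0 t : t \in nonzero_tuples K 'I_k.+1 -> block_point e s t != 0.
  move=> tA; apply/eqP=> /rowP/(_ ord0)/eqP.
  by rewrite block_pointE mxE (negPf (tn0 _ _ tA)).
have t0 t : t \in nonzero_tuples K 'I_k.+1 -> (\row_i t i : 'rV[K]_k.+1) != 0.
  move=> tA; apply/eqP=> /rowP/(_ ord0)/eqP.
  by rewrite !mxE (negPf (tn0 _ _ tA)).
(* Every block contains its matching edge, so a variable can be chosen in it to replace that of
   index [i]. *)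
have ex_edge i : exists a : 'I_s.+1, block (tnth ed a) == i.
  have : [set odd_vertex i; even_vertex i] \in ed.
    rewrite (edges_mem hed); apply/edge_setP; exists i, (even_vertex i).
      by rewrite /= odd_double.
    by split=> //; apply: adj_matching he i.
  by case/tnthP=> a aE; exists a; rewrite -aE block_edge //= odd_double.
pose h i := xchoose (ex_edge i).
apply/eqP; rewrite eqn_leq; apply/andP; split.
  apply: (leq_hilbert_image (h := fun a => block (tnth ed a))) => // t a _.
  by rewrite block_pointE mxE.
apply: (leq_hilbert_image (h := h)) => // t i _.
by rewrite block_pointE mxE (eqP (xchooseP (ex_edge i))).
Qed.

(** Coordinates of points of X are products of nonzero parameters, up to a nonzero scalar; this
    makes division by X_1^d legitimate. *)
Lemma toric_set_coord_neq0 (K : finFieldType) P (v : 'rV[K]_s.+1) a :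
  P \in toric_set K ed -> v \in proj_set P -> v 0 a != 0.
Proof.
rewrite inE => /existsP[t /andP[]]; rewrite inE => /forallP t0.
have [w w0 ->] := proj_pointP P.
case/imsetP=> b b0 tE /imsetP[c]; rewrite inE => c0 ->.
have : edge_point ed t 0 a != 0 by rewrite mxE; apply/prodf_neq0.
by rewrite tE !mxE !mulf_eq0 (negPf c0); case/norP.
Qed.

End Blocks.

Theorem theorem5p2 (K : finFieldType) (k s : nat)
    (e : rel 'I_((k.+1).*2)) (he : matched_bipartite e)
    (ed : s.+1.-tuple {set 'I_((k.+1).*2)}) (hed : edge_ordering e ed)
    (d : nat) :
  let X : {set proj_point K s} := toric_set K ed in
  let Y : {set proj_point K s} := block_set e K s in
  (\dim (eval_code X d) = hilbert X d)%N /\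
  (hilbert X d = hilbert_psi Y X d + hilbert (proj_torus K k) d)%N.
Proof.
move=> X Y; split.
  by apply: dim_eval_code => P v; apply: toric_set_coord_neq0.
by rewrite -(hilbert_block_set he hed); apply/hilbert_psiD/block_set_sub.
Qed.
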